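(* Let $G$ be a graph containing no isolated edge, and let $v_iv_j\in E(G)$ be an edge such that the graph $G-v_iv_j$ also contains no isolated edge. Then $$ASO(G)>ASO(G-v_iv_j).$$
   Context: All graphs are finite and simple. An isolated edge of a graph is an edge both of whose endvertices have degree $1$ (equivalently, a connected component isomorphic to the path $P_2$). $G-v_iv_j$ denotes the graph obtained from $G$ by deleting the edge $v_iv_j$ (keeping all vertices). For a graph $H$ with no isolated edge, the augmented Sombor index is $ASO(H)=\sum_{v_rv_s\in E(H)}\sqrt{\frac{d_r^2+d_s^2}{d_r+d_s-2}}$, where $d_r$ denotes the degree of vertex $v_r$ in $H$ and the sum runs over all edges of $H$. *)

(* Defs.v *)
From mathcomp Require Import all_boot all_order all_algebra.
From mathcomp Require Import reals.

Set Implicit Arguments.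
Unset Strict Implicit.
Unset Printing Implicit Defensive.

Import Order.TTheory GRing.Theory Num.Theory.
Local Open Scope ring_scope.

Record sgraph (T : finType) := SGraph {
  adj :> rel T;
  adj_sym : symmetric adj;
  adj_irr : irreflexive adj
}.

Section SGraphTheory.
Variables (R : realType) (T : finType) (G : sgraph T).

Definition edges : {set {set T}} :=
  [set [set p.1; p.2] | p : T * T & adj G p.1 p.2].

Definition degree (x : T) : nat := #|[set y | adj G x y]|.

Definition isolated_edge (x y : T) : Prop :=
  [/\ adj G x y, degree x = 1%N & degree y = 1%N].

Definition no_isolated_edge : Prop := forall x y : T, ~ isolated_edge x y.

Definition del_adj (u v : T) : rel T :=
  [rel x y | adj G x y && ([set x; y] != [set u; v])].

Lemma del_adj_sym (u v : T) : symmetric (del_adj u v).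
Proof. by move=> x y; rewrite /del_adj /= adj_sym setUC. Qed.

Lemma del_adj_irr (u v : T) : irreflexive (del_adj u v).
Proof. by move=> x; rewrite /del_adj /= adj_irr. Qed.

Definition del_edge (u v : T) : sgraph T :=
  SGraph (@del_adj_sym u v) (@del_adj_irr u v).

(* An edge is the two-element set e of its ends, so the sums over e are       *)
(* d_r^2 + d_s^2 and d_r + d_s when e = {r, s}: see aso_weightE. For an       *)
(* isolated edge the denominator is 0 and the weight is the junk value 0.     *)
Definition aso_weight (e : {set T}) : R :=
  Num.sqrt ((\sum_(x in e) (degree x)%:R ^+ 2)
            / ((\sum_(x in e) (degree x)%:R) - 2)).

Definition ASO : R := \sum_(e in edges) aso_weight e.

Lemma mem_edges (x y : T) : ([set x; y] \in edges) = adj G x y.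
Proof.
apply/imsetP/idP => [[[a b]]|Gxy]; last by exists (x, y); rewrite ?inE.
rewrite inE /= => Gab exy.
have aNb : a != b by apply: contraTneq Gab => ->; rewrite adj_irr.
have : a \in [set x; y] by rewrite exy set21.
have : b \in [set x; y] by rewrite exy set22.
by case/set2P=> eb /set2P[] ea; move: Gab aNb; rewrite ea eb ?eqxx // adj_sym.
Qed.

Lemma aso_weightE (x y : T) : adj G x y ->
  aso_weight [set x; y] =
  Num.sqrt (((degree x)%:R ^+ 2 + (degree y)%:R ^+ 2)
            / ((degree x)%:R + (degree y)%:R - 2)).
Proof.
move=> Gxy; have xNy : x \notin [set y].
  by rewrite inE; apply: contraTneq Gxy => ->; rewrite adj_irr.
by rewrite /aso_weight !big_setU1 //= !big_set1.
Qed.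

End SGraphTheory.

(* Main.v *)
Require Import Defs.
From mathcomp Require Import all_boot all_order all_algebra.
From mathcomp Require Import reals.
From mathcomp Require Import zify lra.

Set Implicit Arguments.
Unset Strict Implicit.
Unset Printing Implicit Defensive.

Import Order.TTheory GRing.Theory Num.Theory.
Local Open Scope ring_scope.

(** Write [f(a,b) = sqrt ((a^2 + b^2) / (a + b - 2))].  Deleting the edge
    [uv] removes the term [f(a,b)], where [a] and [b] are the degrees of [u]
    and [v], and changes only the terms of the other edges at [u] or [v].  An
    edge [uy] gains at most [1 / (2 sqrt a)], so the [a - 1] edges at [u] gain
    less than [sqrt a / 2] together, and likewise at [v].  The removed term
    exceeds both gains, since [f(a,b)^2 > (a + b) / 2]. *)

Section Weight.
Variable R : rcfType.

(** If [c < a], then [3 <= a] and lowering [a] by one does not raise the weight. If [a <= c], the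
    squared weight rises by at most 1, which the cross term in the square of the right side absorbs.
    For integers the disjunction excludes only [a = 2], [c = 1], where the left denominator
    vanishes. *)
Lemma weight_pred_le (a c : R) : 1 <= c -> 2 <= a ->
  (a <= c) || (3 <= a) ->
  Num.sqrt (((a - 1) ^+ 2 + c ^+ 2) / (a - 1 + c - 2)) <=
  Num.sqrt ((a ^+ 2 + c ^+ 2) / (a + c - 2)) + (2 * Num.sqrt a)^-1.
Proof.
move=> c1 a2 hac; set g' := _ / (a - 1 + c - 2); set g := _ / (a + c - 2).
have sa0 : 0 < Num.sqrt a by rewrite sqrtr_gt0; lra.
have l0 : 0 < (2 * Num.sqrt a)^-1 by rewrite invr_gt0; lra.
have s0 : 0 < a - 1 + c - 2 by case/orP: hac => ?; lra.
have t0 : 0 < a + c - 2 by lra.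
have [ac|ca] := lerP a c; last first.
  have {hac}a3 : 3 <= a by case/orP: hac => ?; lra.
  apply: (@le_trans _ _ (Num.sqrt g)); last lra.
  apply: ler_wsqrtr; rewrite /g' /g ler_pdivrMr // mulrAC ler_pdivlMr //.
  (* With denominators cleared, right minus left is the sum of the next three products and
     [c - 1]. *)
  have h : 0 <= (c - 1) * (a - c) by apply: mulr_ge0; lra.
  have h2 : 0 <= a * (a - 3) by apply: mulr_ge0; lra.
  have h3 : 0 <= (a - 3) * (c - 1) by apply: mulr_ge0; lra.
  nra.
have g'g : g' <= g + 1.
  have -> : g + 1 = (a ^+ 2 + c ^+ 2 + (a + c - 2)) / (a + c - 2).
    by rewrite [RHS]mulrDl divff // gt_eqF.
  rewrite /g' ler_pdivrMr // mulrAC ler_pdivlMr //.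
  have h2 : 0 <= (c - a) * (a - 2) by apply: mulr_ge0; lra.
  have h3 : 0 <= (a - 2) * (a - 2) by apply: mulr_ge0; lra.
  nra.
have ga : a <= g.
  rewrite /g ler_pdivlMr //.
  have h : 0 <= (c - a) * c by apply: mulr_ge0; lra.
  nra.
have g0 : 0 <= g by lra.
have sag : Num.sqrt a <= Num.sqrt g by apply: ler_wsqrtr.
have hl : 2 * Num.sqrt a * (2 * Num.sqrt a)^-1 = 1 by rewrite divff //; lra.
have sg := sqr_sqrtr g0.
rewrite -[leRHS]ger0_norm; last by rewrite addr_ge0 ?sqrtr_ge0 ?ltW.
rewrite -sqrtr_sqr; apply/ler_wsqrtr/(le_trans g'g).
(* Since [a <= g], the cross term [2 * sqrt g / (2 * sqrt a)] is at least 1. *)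
have : 0 <= (Num.sqrt g - Num.sqrt a) * (2 * Num.sqrt a)^-1.
  by apply: mulr_ge0; lra.
nra.
Qed.

(** The squared mean of the roots is at most [(a + b) / 2]. Strictness comes from the [- 2] in the
    denominator, as [(a + b)^2 <= 2 (a^2 + b^2)]. *)
Lemma mean_sqrt_lt_weight (a b : R) : 0 <= a -> 0 <= b -> 2 < a + b ->
  (Num.sqrt a + Num.sqrt b) / 2 < Num.sqrt ((a ^+ 2 + b ^+ 2) / (a + b - 2)).
Proof.
move=> a0 b0 ab.
have sa := sqr_sqrtr a0; have sb := sqr_sqrtr b0.
have sa0 := sqrtr_ge0 a; have sb0 := sqrtr_ge0 b.
rewrite -[ltLHS]ger0_norm -?sqrtr_sqr; last lra.
have hlt : (a + b) / 2 < (a ^+ 2 + b ^+ 2) / (a + b - 2).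
  rewrite ltr_pdivlMr; last lra.
  have := sqr_ge0 (a - b); nra.
rewrite ltr_sqrt; last by apply: le_lt_trans hlt; lra.
apply: le_lt_trans hlt.
have := sqr_ge0 (Num.sqrt a - Num.sqrt b); nra.
Qed.

End Weight.

Section Graph.
Variable T : finType.
Implicit Types (G : sgraph T) (x y u v : T) (e : {set T}).

Lemma edgesP G e :
  reflect (exists x y, adj G x y /\ e = [set x; y]) (e \in edges G).
Proof.
apply: (iffP imsetP) => [[[x y]]|[x [y [Gxy ->]]]].
  by rewrite inE => Gxy ->; exists x, y.
by exists (x, y); rewrite ?inE.
Qed.

Lemma adj_neq G x y : adj G x y -> x != y.
Proof. by apply: contraTneq => ->; rewrite adj_irr. Qed.

Lemma card_incident_edges G x :
  #|[set e in edges G | x \in e]| = degree G x.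
Proof.
have -> : [set e in edges G | x \in e] =
          [set [set x; y] | y in [set y | adj G x y]].
  apply/setP => e; rewrite inE; apply/andP/imsetP => [[]|[y]].
    case/edgesP=> a [b [Gab ->]] /set2P[] xE.
      by exists b; rewrite ?inE xE.
    by exists a; rewrite ?inE xE 1?adj_sym // setUC.
  by rewrite inE => Gxy ->; rewrite mem_edges Gxy set21.
apply: card_in_imset => y z; rewrite !inE => Gxy Gxz eyz.
have : y \in [set x; z] by rewrite -eyz set22.
by case/set2P => // yx; move: Gxy; rewrite yx adj_irr.
Qed.

(** Double counting of incident pairs, as in the handshake lemma; it turns losses charged per edge
    into losses per vertex. *)
Lemma sum_edges_ends (V : nmodType) G (F : T -> V) :
  \sum_(e in edges G) \sum_(x in e) F x = \sum_x F x *+ degree G x.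
Proof.
rewrite (exchange_big_dep predT) //=; apply: eq_bigr => x _.
rewrite -card_incident_edges -sumr_const.
by apply: eq_bigl => e; rewrite inE.
Qed.

Lemma edges_del_edge G u v :
  edges (del_edge G u v) = edges G :\ [set u; v].
Proof.
apply/setP => e; rewrite in_setD1; apply/edgesP/andP => [[x [y []]]|[euv]].
  by rewrite /= => /andP[Gxy ?] ->; rewrite mem_edges.
case/edgesP => x [y [Gxy eE]]; exists x, y.
by split=> //; apply/andP; split=> //; rewrite -eE.
Qed.

Lemma degree_del_edge G u v x : adj G u v ->
  degree G x = ((x \in [set u; v]) + degree (del_edge G u v) x)%N.
Proof.
move=> Guv; rewrite -!card_incident_edges edges_del_edge.
rewrite (cardsD1 [set u; v]) inE mem_edges Guv; congr (_ + _)%N.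
by apply: eq_card => e; rewrite !inE andbA.
Qed.

Lemma degree_gt0 G x y : adj G x y -> (0 < degree G x)%N.
Proof. by move=> Gxy; apply/card_gt0P; exists y; rewrite inE. Qed.

Lemma degree_sum_gt2 G x y : no_isolated_edge G -> adj G x y ->
  (2 < degree G x + degree G y)%N.
Proof.
move=> hG Gxy; have dx := degree_gt0 Gxy.
have dy : (0 < degree G y)%N by apply: (@degree_gt0 G y x); rewrite adj_sym.
rewrite ltnNge; apply/negP => d2; apply: (hG x y).
by split=> //; move: dx dy d2; lia.
Qed.

Variable R : realType.

Definition end_loss G u v x : R :=
  if x \in [set u; v] then (2 * Num.sqrt (degree G x)%:R)^-1 else 0.

Lemma aso_weight_del_end G u v x y :
  no_isolated_edge (del_edge G u v) -> adj G u v ->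
  adj (del_edge G u v) x y -> x \in [set u; v] -> y \notin [set u; v] ->
  aso_weight R (del_edge G u v) [set x; y] <=
  aso_weight R G [set x; y] + (2 * Num.sqrt (degree G x)%:R)^-1.
Proof.
move=> hG' Guv G'xy xuv yuv.
have Gxy : adj G x y by case/andP: G'xy.
have dx := degree_del_edge x Guv; have dy := degree_del_edge y Guv.
have d2 := degree_sum_gt2 hG' G'xy; have d0 := degree_gt0 G'xy.
have e0 : (0 < degree (del_edge G u v) y)%N.
  by apply: (@degree_gt0 _ y x); rewrite adj_sym.
rewrite !aso_weightE //; rewrite xuv (negbTE yuv) in dx dy.
have -> : (degree (del_edge G u v) x)%:R = (degree G x)%:R - 1 :> R.
  by rewrite dx natrD addrAC subrr add0r.
rewrite -[degree (del_edge G u v) y]add0n -dy.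
(* The surviving edge is not isolated, so its new degrees sum to at least 3; this rules out the pair
   (2, 1) of old degrees. *)
apply: weight_pred_le; rewrite ?ler1n ?ler_nat; move: dx dy d2 d0 e0; lia.
Qed.

Lemma aso_weight_del_edge G u v e :
  no_isolated_edge (del_edge G u v) -> adj G u v ->
  e \in edges (del_edge G u v) ->
  aso_weight R (del_edge G u v) e <=
  aso_weight R G e + \sum_(x in e) end_loss G u v x.
Proof.
move=> hG' Guv /edgesP[x [y [G'xy ->]]].
have /andP[/= Gxy xyuv] := G'xy.
have xy := adj_neq Gxy.
rewrite big_setU1 ?inE //= big_set1 /end_loss.
have [xuv|xuv] := boolP (x \in [set u; v]);
  have [yuv|yuv] := boolP (y \in [set u; v]).
(* With both ends in [[set u; v]], the edge would be the deleted one; hence at most one end changes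
   degree. *)
- case/negP: xyuv; rewrite eqEcard !cards2 xy (adj_neq Guv) andbT.
  by apply/subsetP => z /set2P[] ->.
- by rewrite addr0; apply: aso_weight_del_end.
- by rewrite add0r setUC; apply: aso_weight_del_end; rewrite // adj_sym.
- rewrite !addr0 !aso_weightE // (degree_del_edge x Guv).
  by rewrite (degree_del_edge y Guv) (negbTE xuv) (negbTE yuv).
Qed.

(** With [a] the old degree, [(a - 1) / (2 sqrt a) <= sqrt a / 2]. *)
Lemma end_loss_degree_le G u v x : adj G u v -> x \in [set u; v] ->
  end_loss G u v x *+ degree (del_edge G u v) x <=
  Num.sqrt (degree G x)%:R / 2.
Proof.
move=> Guv xuv; rewrite /end_loss xuv -[leLHS]mulr_natr mulrC.
have dx := degree_del_edge x Guv; rewrite xuv in dx.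
have d0 : 0 < (degree G x)%:R :> R by rewrite ltr0n dx.
have s0 : 0 < Num.sqrt (degree G x)%:R :> R by rewrite sqrtr_gt0.
have ss := sqr_sqrtr (ltW d0).
rewrite ler_pdivrMr; last by rewrite mulr_gt0.
rewrite mulrA divfK ?pnatr_eq0 // -expr2 ss ler_nat dx; lia.
Qed.

End Graph.

Theorem theorem2 (R : realType) (T : finType) (G : sgraph T) (vi vj : T)
    (hG : no_isolated_edge G)
    (hij : [set vi; vj] \in edges G)
    (hGij : no_isolated_edge (del_edge G vi vj)) :
  ASO R G > ASO R (del_edge G vi vj).
Proof.
have Gij : adj G vi vj by rewrite -mem_edges.
rewrite /ASO (big_setD1 _ hij) /= -edges_del_edge.
set E := edges _.
apply: (@le_lt_trans _ _
  (\sum_(e in E) (aso_weight R G e + \sum_(x in e) end_loss R G vi vj x))).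
  by apply: ler_sum => e; apply: aso_weight_del_edge.
(* The weights in [G] of the surviving edges cancel, leaving the total loss against the weight of
   the removed edge. *)
rewrite big_split /= addrC ltrD2r sum_edges_ends.
rewrite (bigID (mem [set vi; vj])) /= [X in _ + X]big1 ?addr0; last first.
  by move=> x xij; rewrite /end_loss (negbTE xij) mul0rn.
rewrite big_setU1 ?inE ?(adj_neq Gij) //= big_set1 aso_weightE //.
have := degree_sum_gt2 hG Gij; rewrite -(ltr_nat R) natrD => d2.
apply: le_lt_trans (mean_sqrt_lt_weight _ _ d2); rewrite ?ler0n //.
by rewrite mulrDl; apply: lerD; apply: end_loss_degree_le;
  rewrite // !inE eqxx ?orbT.
Qed.
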